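(* Let $\pi$ be an action of an amenable unimodular locally compact group $G$ and let $\phi$ be the restriction of $\pi$ to a uniform lattice $\omega\subseteq G$. Let $K$ be the closure of a regular and precompact fundamental domain of $\omega$. (i) If $\pi$ is a measure preserving action on a probability space $(X,\mu)$, then so is $\phi$, and $$\operatorname{E}^{(OW)}_\mu(\pi)=\operatorname{dens}(\omega)\operatorname{E}^{(OW)}_\mu(\phi).$$ (ii) If $\pi$ is a continuous action on a compact Hausdorff space $X$, then so is $\phi$, and for every $f\in C(X)$, $$\operatorname{p}^{(OW)}_f(\pi)=\operatorname{dens}(\omega)\operatorname{p}^{(OW)}_{f_K}(\phi).$$
   Context: Topological groups are Hausdorff; $\theta$ is a fixed Haar measure on $G$; on the discrete group $\omega$ the Haar measure used is counting measure. $C(X)$ is the space of continuous real-valued functions on $X$. A uniform lattice in $G$ is a discrete subgroup $\omega$ with $G/\omega$ compact. A fundamental domain of $\omega$ is a Borel set $C\subseteq G$ such that each $g\in G$ can be written uniquely as $g=cv$ with $c\in C$, $v\in\omega$. It is regular if its topological boundary satisfies $\theta(\partial C)=0$, and precompact if its closure is compact. For a unimodular locally compact group $H$ with Haar measure $\theta_H$ and $L,A\subseteq H$ put $\partial_L A=L\overline{A}\cap L\overline{H\setminus A}$. A net $(A_i)_{i\in I}$ of compact subsets of $H$ is van Hove if $\lim_i\theta_H(\partial_L A_i)/\theta_H(A_i)=0$ for every compact $L\subseteq H$ (implicitly $\theta_H(A_i)>0$ for large $i$). A set $D\subseteq H$ is Delone if it is uniformly discrete (there is a neighbourhood $U$ of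 the neutral element such that $(gU)_{g\in D}$ is a disjoint family) and relatively dense ($LD=H$ for some compact $L\subseteq H$). The density is $\operatorname{dens}(\omega)=\lim_{i\in I}|A_i\cap\omega|/\theta(A_i)$ for a van Hove net $(A_i)_{i\in I}$ in $G$ (the limit exists and does not depend on the net). An action of a topological group $H$ on a probability space $(X,\mu)$ is measure preserving if each map $x\mapsto g.x$ is measurable, $\mu(g.A)=\mu(A)$ for all $g\in H$ and measurable $A$, and $g\mapsto\mu(A\triangle g.A)$ is continuous on $H$ for every measurable $A$. For a finite set $\mathcal{U}$ of subsets of $X$ and finite $F\subseteq H$ let $\mathcal{U}_F=\{\bigcap_{g\in F}g^{-1}.U(g)\mid U\in\mathcal{U}^F\}$, where $\mathcal{U}^F$ is the set of all maps $F\to\mathcal{U}$. Put $H_\mu(\alpha)=-\sum_{A\in\alpha,\ \mu(A)>0}\mu(A)\log\mu(A)$ for a finite measurable partition $\alpha$, and $$P_f(\mathcal{U})=\log\Big(\sum_{U\in\mathcal{U}}\sup_{x\in U}e^{f(x)}\Big)$$ for $f\in C(X)$ and a finite open cover $\mathcal{U}$ of $X$. For an action $\psi$ of an amenable unimodular locally compact group $H$, with a van Hove net $(A_i)_{i\in I}$ and a Delone set $D$ in $H$, $$\operatorname{E}^{(OW)}_\mu(\psi)=\sup_\alpha\limsup_{i\in I}\frac{H_\mu(\alpha_{A_i\cap D})}{\theta_H(A_i)},\qquad \operatorname{p}^{(OW)}_f(\psi)=\sup_{\mathcal{U}}\limsup_{i\in I}\frac{P_{f_{A_i}}(\mathcal{U}_{A_i\cap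 D})}{\theta_H(A_i)},$$ where $\alpha$ ranges over all finite measurable partitions and $\mathcal{U}$ over all finite open covers of $X$, and $f_A(x)=\int_A f(g.x)\,d\theta_H(g)$ for compact $A\subseteq H$. The notation omits the van Hove net and the Delone set because both quantities are taken to be independent of these choices. In the claim, $f_K(x)=\int_K f(g.x)\,d\theta(g)$ with the Haar measure $\theta$ of $G$.
   Formalization: The equality in (i), resp. (ii), is stated under the explicit hypothesis that E_μ(π), resp. p_f(π) for the given f, is independent of the van Hove net and Delone set; with the definitions as given this independence can fail. *)

(* Defs.v *)
From HB Require Import structures.
From mathcomp Require Import all_boot all_order all_algebra.
From mathcomp Require Import all_classical all_reals all_analysis.

Set Implicit Arguments.
Unset Strict Implicit.
Unset Printing Implicit Defensive.

Import Order.TTheory GRing.Theory Num.Theory.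
Import numFieldNormedType.Exports.

Local Open Scope quotient_scope.
Local Open Scope classical_set_scope.
Local Open Scope ring_scope.

HB.mixin Record isTopologicalGroup G of Topological G & Group G := {
  mulg_continuous : continuous (fun p : G * G => (p.1 * p.2)%g);
  invg_continuous : continuous (fun x : G => (x^-1)%g)
}.

#[short(type="topologicalGroupType")]
HB.structure Definition TopologicalGroup :=
  {G of Topological G & Group G & isTopologicalGroup G}.

Definition setMg (G : groupType) (A B : set G) : set G :=
  [set (a * b)%g | a in A & b in B].
Notation "A *` B" := (setMg A B)
  (at level 40, left associativity) : classical_set_scope.

Definition boundary (T : topologicalType) (A : set T) : set T :=
  closure A `\` interior A.

(* [g_sigma_algebraType] needs a pointed type; [borel G] is [G] pointed at 1. *)
Definition pointed_at_1 (G : topologicalGroupType) : Type := G.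
HB.instance Definition _ (G : topologicalGroupType) :=
  Topological.on (pointed_at_1 G).
HB.instance Definition _ (G : topologicalGroupType) :=
  isPointed.Build (pointed_at_1 G) (1%g : G).

Notation borel G := (g_sigma_algebraType (@open (pointed_at_1 G))).

Section haar_measure.
Context (R : realType) (G : topologicalGroupType).
Local Open Scope ereal_scope.

Record is_haar (theta : {measure set (borel G) -> \bar R}) : Prop := {
  haar_neq0 : theta setT != 0;
  haar_mull : forall (g : G) (A : set G), measurable (A : set (borel G)) ->
    theta ([set g] *` A) = theta A;
  haar_compact_fin : forall A : set G, compact A -> theta A < +oo;
  haar_outer_regular : forall A : set G, measurable (A : set (borel G)) ->
    theta A = ereal_inf [set theta U | U in [set U : set G | open U /\ A `<=` U]];
  haar_inner_regular : forall U : set G, open U ->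
    theta U = ereal_sup [set theta A | A in [set A : set G | compact A /\ A `<=` U]]
}.

Definition unimodular :=
  forall theta : {measure set (borel G) -> \bar R}, is_haar theta ->
  forall (g : G) (A : set G), measurable (A : set (borel G)) ->
    theta (A *` [set g]) = theta A.

End haar_measure.

(* Existence of a left-invariant mean on the bounded continuous functions.
   The functional [m] is total, but constrained on these functions only. *)
Definition bounded_continuous (R : realType) (T : topologicalType) (f : T -> R) :=
  continuous f /\ exists M, forall x, `|f x| <= M.

Definition amenable (R : realType) (G : topologicalGroupType) :=
  exists m : (G -> R) -> R,
    [/\ m (cst 1) = 1,
        forall f, bounded_continuous f -> (forall x, 0 <= f x) -> 0 <= m f,
        forall (a : R) f h, bounded_continuous f -> bounded_continuous h ->
          m (fun x => a * f x + h x) = a * m f + m h &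
        forall (g : G) f, bounded_continuous f -> m (fun x => f (g * x)%g) = m f].

Record subgroup (G : topologicalGroupType) := Subgroup {
  subgroup_set :> set G;
  subgroup1 : subgroup_set 1%g;
  subgroupM : forall x y, subgroup_set x -> subgroup_set y -> subgroup_set (x * y)%g;
  subgroupV : forall x, subgroup_set x -> subgroup_set (x^-1)%g
}.

(* A subgroup as a topological group in its own right, with the topology that
   the library puts on [set_type], i.e. the one induced from [G]. *)
Definition subgroup_type (G : topologicalGroupType) (W : subgroup G) : Type :=
  set_type W.

Section subgroup_topological_group.
Context (G : topologicalGroupType) (W : subgroup G).
Local Notation T := (subgroup_type W).

HB.instance Definition _ := SubChoice.copy T (set_type W).
HB.instance Definition _ := Topological.copy T (set_type W).

Let mem_sub (x : G) : subgroup_set W x -> x \in (W : set G).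
Proof. by rewrite inE. Qed.
Let sub_mem (u : T) : subgroup_set W (val u).
Proof. by have := valP u; rewrite inE. Qed.

Definition sub_one : T := Sub 1%g (mem_sub (subgroup1 W)).
Definition sub_mul (u v : T) : T :=
  Sub (val u * val v)%g (mem_sub (subgroupM (sub_mem u) (sub_mem v))).
Definition sub_inv (u : T) : T :=
  Sub (val u)^-1%g (mem_sub (subgroupV (sub_mem u))).

Lemma sub_mulA : associative sub_mul.
Proof. by move=> u v w; apply/val_inj; rewrite !SubK mulgA. Qed.
Lemma sub_mul1g : left_id sub_one sub_mul.
Proof. by move=> u; apply/val_inj; rewrite !SubK mul1g. Qed.
Lemma sub_mulg1 : right_id sub_one sub_mul.
Proof. by move=> u; apply/val_inj; rewrite !SubK mulg1. Qed.
Lemma sub_mulVg : left_inverse sub_one sub_inv sub_mul.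
Proof. by move=> u; apply/val_inj; rewrite !SubK mulVg. Qed.
Lemma sub_mulgV : right_inverse sub_one sub_inv sub_mul.
Proof. by move=> u; apply/val_inj; rewrite !SubK mulgV. Qed.

HB.instance Definition _ :=
  isGroup.Build T sub_mulA sub_mul1g sub_mulg1 sub_mulVg sub_mulgV.

Let val_continuous : continuous (val : T -> G).
Proof. exact: initial_continuous. Qed.

Let continuous_sub (S : topologicalType) (h : S -> T) :
  continuous (val \o h) -> continuous h.
Proof.
move=> /continuousP ch; apply/continuousP => _ [A oA <-].
by rewrite -comp_preimage; exact: ch.
Qed.

Lemma sub_mul_continuous : continuous (fun p : T * T => (p.1 * p.2)%g).
Proof.
apply: continuous_sub => p.
have c1 : (fun q : T * T => (val q.1, val q.2)) @ p --> (val p.1, val p.2).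
  apply: cvg_pair.
    exact: (@cvg_comp _ _ _ fst val _ _ _ cvg_fst (@val_continuous p.1)).
  exact: (@cvg_comp _ _ _ snd val _ _ _ cvg_snd (@val_continuous p.2)).
exact: (@cvg_comp _ _ _ (fun q : T * T => (val q.1, val q.2))
  (fun r : G * G => (r.1 * r.2)%g) _ _ _ c1
  (@mulg_continuous G (val p.1, val p.2))).
Qed.

Lemma sub_inv_continuous : continuous (fun u : T => (u^-1)%g).
Proof.
apply: continuous_sub => u.
exact: (@cvg_comp _ _ _ val (fun r : G => r^-1%g) _ _ _
  (@val_continuous u) (@invg_continuous G (val u))).
Qed.

HB.instance Definition _ :=
  isTopologicalGroup.Build T sub_mul_continuous sub_inv_continuous.

Definition lcoset_rel : rel G := fun x y => `[< subgroup_set W (x^-1 * y)%g >].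

Lemma lcoset_equiv_class : equiv_class_of lcoset_rel.
Proof.
split=> [x|x y|y x z].
- by apply/asboolP; rewrite mulVg; exact: subgroup1.
- by apply/asbool_equiv_eq; split=> /subgroupV; rewrite invgM invgK.
- move=> /asboolP xy /asboolP yz; apply/asboolP.
  by have := subgroupM xy yz; rewrite mulgA mulgK.
Qed.

Canonical lcoset_equiv := EquivRelPack lcoset_equiv_class.

Definition left_cosets := quotient_topology {eq_quot lcoset_equiv}.
HB.instance Definition _ := Topological.on left_cosets.

Definition uniform_lattice :=
  (forall v : T, open [set v]) /\ compact [set: left_cosets].

Definition fundamental_domain (C : set G) :=
  measurable (C : set (borel G)) /\
  forall g, exists! p : G * G, [/\ C p.1, subgroup_set W p.2 & g = (p.1 * p.2)%g].

Definition restrict_action X (act : G -> X -> X) : T -> X -> X :=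
  fun v => act (val v).

End subgroup_topological_group.
Arguments restrict_action {G} W {X} act.

(* A net is a family indexed by a nonempty directed preordered set. *)
Record directed := Directed {
  dindex :> Type;
  dle : dindex -> dindex -> Prop;
  dle_refl : forall i, dle i i;
  dle_trans : forall i j k, dle i j -> dle j k -> dle i k;
  dle_ub : forall i j, exists k, dle i k /\ dle j k;
  dindex_inh : inhabited dindex
}.

Definition tail (I : directed) : set_system I :=
  [set S | exists i, forall j, dle i j -> S j].
Arguments tail : clear implicits.

Definition net_limsup (R : realType) (I : directed) (u : I -> \bar R) : \bar R :=
  ereal_inf [set ereal_sup [set u j | j in [set j | dle i j]] | i in [set: I]].

Section van_hove.
Context (R : realType) (H : topologicalGroupType).
Context (theta : {measure set (borel H) -> \bar R}).

Definition vh_boundary (L A : set H) : set H :=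
  (L *` closure A) `&` (L *` closure (~` A)).

Record van_hove_net := VanHoveNet {
  vh_index :> directed;
  vh_set :> vh_index -> set H;
  vh_compact : forall i, compact (vh_set i);
  vh_pos : \forall i \near tail vh_index, (0 < theta (vh_set i))%E;
  vh_lim : forall L : set H, compact L ->
    (fun i => fine (theta (vh_boundary L (vh_set i))) / fine (theta (vh_set i)))
      @ tail vh_index --> (0 : R)
}.

Definition delone (D : set H) :=
  (exists2 U : set H, nbhs (1%g : H) U & trivIset D (fun g => [set g] *` U)) /\
  (exists2 L : set H, compact L & L *` D = setT).

(* The Ornstein-Weiss quantities below are functions of such a choice, which
   usual notation omits because they are taken to be independent of it. *)
Record OW_choice := OWChoice {
  OW_net :> van_hove_net;
  OW_delone : set H;
  OW_deloneP : delone OW_delone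
}.

End van_hove.

Definition density (R : realType) (G : topologicalGroupType)
    (theta : {measure set (borel G) -> \bar R}) (W : set G)
    (A : van_hove_net theta) : R :=
  lim ((fun i => fine (counting (A i `&` W) : \bar R) / fine (theta (A i)))
    @ tail A).

Definition is_action (H : topologicalGroupType) X (act : H -> X -> X) :=
  (forall x, act 1%g x = x) /\
  (forall g h x, act (g * h)%g x = act g (act h x)).

Definition measure_preserving_action (R : realType) (H : topologicalGroupType)
    d (X : measurableType d) (mu : probability X R) (act : H -> X -> X) :=
  [/\ is_action act,
      forall g, measurable_fun setT (act g),
      forall g A, measurable A -> mu (act g @` A) = mu A &
      forall A, measurable A ->
        continuous (fun g : H => fine (mu (A `+` (act g @` A))))].

Definition continuous_action (H : topologicalGroupType) (X : topologicalType)
    (act : H -> X -> X) :=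
  is_action act /\ continuous (fun p : H * X => act p.1 p.2).

(* [g^-1 . u g] is taken as an image, not as a preimage; only the values of
   [u] on [F] matter. *)
Definition refinement (H : groupType) X (act : H -> X -> X)
    (U : set (set X)) (F : set H) : set (set X) :=
  [set \bigcap_(g in F) (act g^-1%g @` u g) |
    u in [set u : H -> set X | forall g, F g -> U (u g)]].

Section entropy.
Context (R : realType) d (X : measurableType d) (mu : probability X R).

Definition finite_partition (alpha : set (set X)) :=
  [/\ finite_set alpha, forall A, alpha A -> measurable A,
      trivIset alpha id & \bigcup_(A in alpha) A = setT].

Definition static_entropy (alpha : set (set X)) : R :=
  - \sum_(A \in [set A | alpha A /\ (0 < mu A)%E]) fine (mu A) * ln (fine (mu A)).

Definition OW_entropy (H : topologicalGroupType)
    (theta : {measure set (borel H) -> \bar R})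
    (act : H -> X -> X) (c : OW_choice theta) : \bar R :=
  ereal_sup [set net_limsup (fun i : c =>
      (static_entropy (refinement act alpha (c i `&` OW_delone c)) /
       fine (theta (c i)))%:E)
    | alpha in finite_partition].

End entropy.

Section pressure.
Context (R : realType) (X : topologicalType).

Definition finite_open_cover (U : set (set X)) :=
  [/\ finite_set U, forall A, U A -> open A & \bigcup_(A in U) A = setT].

(* [sup] of the empty set is 0, as it should be for the positive function
   exp o f; [lne 0] is -oo, which only occurs if X is empty. *)
Definition static_pressure (f : X -> R) (U : set (set X)) : \bar R :=
  lne (\sum_(A \in U) sup [set expR (f x) | x in A])%:E.

Definition orbit_integral (H : topologicalGroupType)
    (theta : {measure set (borel H) -> \bar R})
    (act : H -> X -> X) (f : X -> R) (A : set H) (x : X) : R :=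
  \int[theta]_(g in (A : set (borel H))) f (act g x).

Definition OW_pressure (H : topologicalGroupType)
    (theta : {measure set (borel H) -> \bar R})
    (act : H -> X -> X) (f : X -> R) (c : OW_choice theta) : \bar R :=
  ereal_sup [set net_limsup (fun i : c =>
      (static_pressure (orbit_integral theta act f (c i))
         (refinement act U (c i `&` OW_delone c)) *
       ((fine (theta (c i)))^-1)%:E)%E)
    | U in finite_open_cover].

End pressure.

Definition counting_haar (R : realType) (H : topologicalGroupType) :
    {measure set (borel H) -> \bar R} := @counting H R.

(* Main.v *)
(* Transport the whole situation from the lattice to G along the tiling of G by
   the translates K v (v in omega).  Given a van Hove net (B_i) and a Delone
   set D in omega, the sets K B_i form a van Hove net in G, because the
   L-boundary of K B lies in K times the M-boundary of B for
   M = omega `&` K^-1 L K, which is finite.  If c0 is an interior point of C then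
   c0 v lies in K only for v = 1, so K B_i meets the Delone set c0 D exactly in
   c0 (B_i `&` D).  Hence the refinement of alpha along K B_i `&` c0 D is the
   refinement of c0^-1 alpha along B_i `&` D, and alpha |-> c0^-1 alpha permutes
   the partitions (resp. covers) over which the supremum is taken.  Since
   theta (K B_i) = theta C * |B_i| and the integral of f over K B_i is the sum
   over B_i of the translates of f_K, the two quantities differ exactly by the
   factor (theta C)^-1, which is the density of omega. *)
Require Import Defs.
From HB Require Import structures.
From mathcomp Require Import all_boot all_order all_algebra finmap.
From mathcomp Require Import all_classical all_reals all_analysis.

Set Implicit Arguments.
Unset Strict Implicit.
Unset Printing Implicit Defensive.

Import Order.TTheory GRing.Theory Num.Theory.
Import numFieldNormedType.Exports.
Local Open Scope classical_set_scope.
Local Open Scope ring_scope.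

(* [all_analysis] rebinds this notation to the scaling of balls. *)
Local Notation "A *` B" := (setMg A B) : classical_set_scope.

(** * Products of sets in a topological group *)

Section topological_group_sets.
Context (G : topologicalGroupType).
Implicit Types (A B L K F : set G) (g x y : G).

Lemma setMgSS A A' B B' : A `<=` A' -> B `<=` B' -> A *` B `<=` A' *` B'.
Proof. by move=> AA BB _ [a /AA ? [b /BB ? <-]]; exists a => //; exists b. Qed.

Lemma setMg1r A g : A *` [set g] = (fun x => x * g)%g @` A.
Proof.
apply/seteqP; split; first by move=> _ [a Aa [_ -> <-]]; exists a.
by move=> _ [a Aa <-]; exists a => //; exists g.
Qed.

Lemma setMg1r_preimage A g : A *` [set g] = (fun x => x * g^-1)%g @^-1` A.
Proof.
rewrite setMg1r; apply/seteqP; split; first by move=> _ [a Aa <-] /=; rewrite mulgK.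
by move=> x /= Ax; exists (x * g^-1)%g => //; rewrite mulgVK.
Qed.

Lemma continuous_mulg (T : topologicalType) (f h : T -> G) :
  continuous f -> continuous h -> continuous (fun t => f t * h t)%g.
Proof.
move=> cf ch x.
have fhx : (fun t => (f t, h t)) @ x --> (f x, h x) by apply: cvg_pair; [exact: cf|exact: ch].
exact: (@cvg_comp _ _ _ (fun t => (f t, h t)) (fun p : G * G => (p.1 * p.2)%g)
  _ _ _ fhx (@mulg_continuous G (f x, h x))).
Qed.

Lemma continuous_invg (T : topologicalType) (f : T -> G) :
  continuous f -> continuous (fun t => (f t)^-1)%g.
Proof.
move=> cf x; exact: (@cvg_comp _ _ _ f (fun r : G => r^-1%g) _ _ _
  (cf x) (@invg_continuous G (f x))).
Qed.

Lemma continuous_rmulg g : continuous (fun x => x * g)%g.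
Proof. by apply: continuous_mulg => [|] x; [exact: cvg_id|exact: cvg_cst]. Qed.

Lemma compact_setMg A B : compact A -> compact B -> compact (A *` B).
Proof.
move=> cA cB; have -> : A *` B = (fun p : G * G => (p.1 * p.2)%g) @` (A `*` B).
  apply/seteqP; split; first by move=> _ [a Aa [b Bb <-]]; exists (a, b).
  by move=> _ [[a b] [/= Aa Bb] <-]; exists a => //; exists b.
apply: continuous_compact; last exact: compact_setX.
exact/continuous_subspaceT/mulg_continuous.
Qed.

(** If [x] lies outside [A B], then for each [a] in [A] the point [a^-1 z] stays in the open
    complement of [B] for parameters near [(a, x)]. Compactness of [A] makes the neighbourhood of
    [x] uniform in [a]. *)
Lemma closed_compact_setMg A B : compact A -> closed B -> closed (A *` B).
Proof.
move=> cA cB; rewrite closedE => x nx; apply: contrapT => nABx.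
apply: nx.
have : \forall z \near x, A `<=` (fun a => ~ B (a^-1 * z)%g).
  move/compact_near_coveringP: cA; apply => a Aa.
  have ca : continuous (fun p : G * G => p.1^-1 * p.2)%g.
    by apply: continuous_mulg; [apply: continuous_invg|]; move=> p;
      [exact: cvg_fst|exact: cvg_snd].
  have := ca (a, x) (~` B); apply; apply: open_nbhs_nbhs; split.
    exact: closed_openC.
  by move=> /= Bax; apply: nABx; exists a => //; exists (a^-1 * x)%g; rewrite ?mulVKg.
apply: filterS => z zA [a Aa [b Bb abz]]; apply: (zA a Aa).
by rewrite -abz mulKg.
Qed.

Lemma finite_setMg A B : finite_set A -> finite_set B -> finite_set (A *` B).
Proof. exact: finite_image2. Qed.

(* Covering compactness is only available for pointed spaces in the library,
   whence the detour through [pointed_at_1]. *)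
Lemma compact_finite_local A F : compact A ->
  (forall x, A x -> exists2 N, nbhs x N & finite_set (N `&` F)) ->
  finite_set (A `&` F).
Proof.
move=> + h; rewrite -[compact A]/(@compact (pointed_at_1 G) A) compact_cover => cA.
pose D := [set V : set G | open V /\ finite_set (V `&` F)].
have [|x Ax|S SD AS] := cA (set G) D id.
- by move=> V [].
- have [N + NF] := h x Ax; rewrite nbhsE => -[V [oV Vx] VN].
  by exists V => //; split => //; apply: sub_finite_set NF => y [/VN].
have : A `&` F `<=` \bigcup_(V in [set` S]) (V `&` F).
  by move=> x [/AS [V SV Vx] Fx]; exists V.
move/sub_finite_set; apply.
apply: bigcup_finite; first exact: finite_fset.
by move=> V /SD; rewrite inE => -[].
Qed.

End topological_group_sets.

(** * Discrete subgroups: finiteness and closedness *)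

Section discrete_subgroup.
Context (G : topologicalGroupType) (W : subgroup G).
Local Notation T := (subgroup_type W).
Hypothesis discrete_W : forall v : T, open [set v].
Implicit Types (S : set T) (u v : T).

Lemma subgroup_val (x : G) : subgroup_set W x -> exists v : T, val v = x.
Proof. by move=> Wx; exists (Sub x (mem_set Wx)); rewrite SubK. Qed.

Lemma val_subgroup v : subgroup_set W (val v).
Proof. by have := valP v; rewrite inE. Qed.

Lemma discrete_subgroup_open S : open S.
Proof. by rewrite -[S]image_id -bigcup_imset1; apply: bigcup_open => v _. Qed.

Lemma discrete_subgroup_closure S : closure S = S.
Proof.
apply/esym/closure_id; rewrite -(setCK S).
by apply: open_closedC; exact: discrete_subgroup_open.
Qed.

(** Continuity of [p^-1 q] at [(x, x)] gives [N] with [N^-1 N] inside an open set whose only lattice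
    point is 1. The centre [x] is an arbitrary point of [G], so the lattice cannot accumulate
    anywhere, on or off itself. *)
Lemma discrete_subgroup_sep (x : G) :
  exists2 N, nbhs x N & forall u v, N (val u) -> N (val v) -> u = v.
Proof.
(* Open sets of the subgroup are traces of open sets of [G], so [U] is open in [G] and contains no
   lattice point but 1. *)
have [U oU U1] : open [set (1%g : T)] by exact: discrete_W.
have cV : continuous (fun p : G * G => p.1^-1 * p.2)%g.
  by apply: continuous_mulg; [apply: continuous_invg|] => p; [exact: cvg_fst|exact: cvg_snd].
have : U (x^-1 * x)%g.
  have : (val @^-1` U) (1%g : T) by rewrite U1.
  by rewrite mulVg.
move=> Ux; have := cV (x, x) U; case; first by apply: open_nbhs_nbhs; split.
move=> [N1 N2] /= [N1x N2x] sub.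
exists (N1 `&` N2); first exact: filterI.
move=> u v [N1u _] [_ N2v]; have /= := sub (val u, val v) (conj N1u N2v) => Uuv.
have : (val @^-1` U) (u^-1 * v)%g by [].
rewrite U1 /= => /(congr1 (fun z => u * z)%g); by rewrite mulVKg mulg1.
Qed.

Lemma finite_val_preimage (Q : set G) : compact Q -> finite_set (val @^-1` Q : set T).
Proof.
move=> cQ; have : finite_set (Q `&` range (val : T -> G)).
  apply: compact_finite_local => // x _.
  have [N Nx sepN] := discrete_subgroup_sep x; exists N => //.
  have [->|/set0P[y [+ [s _ sy]]]] := eqVneq (N `&` range (val : T -> G)) set0.
    exact: finite_set0.
  rewrite -sy => Ns; apply: sub_finite_set (finite_set1 (val s)) => z [+ [u _ uz]].
  rewrite -uz => Nu.
  by rewrite (sepN _ _ Nu Ns).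
move=> fQ; have := @finite_preimage _ _ _ (val : T -> G) (in2W val_inj) fQ.
by apply: sub_finite_set => v Qv; split => //; exists v.
Qed.

Lemma compact_discrete_subgroup S : compact S -> finite_set S.
Proof.
move=> cS; rewrite -(setIT S); apply: (@compact_finite_local T) => // v _.
exists [set v]; last by rewrite setIT; exact: finite_set1.
by apply: open_nbhs_nbhs; split.
Qed.

(** A separating neighbourhood of an adherent point [x] contains a single point of the image. If
    that point were not [x], removing it would leave a neighbourhood of [x] that misses the
    image. *)
Lemma closed_val_image S : hausdorff_space G -> closed (val @` S).
Proof.
move=> hG x Sx; have [N Nx sepN] := discrete_subgroup_sep x.
have [y [[s Ss sy]]] := Sx N Nx; rewrite -sy => Ns.
have [<-|/eqP xs] := eqVneq (val s) x; first by exists s.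
have : nbhs x (~` [set val s]).
  apply: open_nbhs_nbhs; split; first apply: closed_openC.
    exact/accessible_closed_set1/hausdorff_accessible.
  by move=> /esym.
move=> /(filterI Nx)/Sx [z [[s' Ss' sz]]]; rewrite -sz => -[Ns' /=].
by rewrite (sepN _ _ Ns' Ns).
Qed.

End discrete_subgroup.

(** * Borel measurability of topological sets and maps *)

Section borel_sets.
Context (R : realType) (G : topologicalGroupType).
Implicit Types A : set G.

Lemma open_borel A : open A -> measurable (A : set (borel G)).
Proof. by move=> oA; apply: sub_sigma_algebra. Qed.

Lemma closed_borel A : closed A -> measurable (A : set (borel G)).
Proof.
by move=> cA; rewrite -(setCK A); apply: measurableC; apply: open_borel; exact: closed_openC.
Qed.

Lemma compact_borel A : hausdorff_space G -> compact A -> measurable (A : set (borel G)).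
Proof. by move=> hG cA; apply: closed_borel; exact: compact_closed. Qed.

Lemma continuous_borel (H : topologicalGroupType) (f : G -> H) :
  continuous f -> measurable_fun setT (f : borel G -> borel H).
Proof.
move=> /continuousP cf.
apply: (@measurability _ _ (borel G) (borel H) setT f (@open (pointed_at_1 H))) => //.
by move=> _ [U oU <-]; rewrite setTI; apply: open_borel; exact: cf.
Qed.

Lemma continuous_measurable_realfun (f : G -> R) :
  continuous f -> measurable_fun setT (f : borel G -> R).
Proof.
move=> /continuousP cf; apply: (measurability _ (measurable_realfun.RGenOpens.measurableE R)).
move=> _ [_ [x [y ->]] <-]; rewrite setTI.
by apply: open_borel; apply: cf; exact: interval_open.
Qed.

Lemma mulr_borel A (g : G) : measurable (A : set (borel G)) ->
  measurable (setMg A [set g] : set (borel G)).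
Proof.
move=> mA; rewrite setMg1r_preimage -[X in measurable X]setTI.
by apply: continuous_borel => //; exact: continuous_rmulg.
Qed.

End borel_sets.

(** * Basic properties of Haar measure *)

Section haar_basics.
Context (R : realType) (G : topologicalGroupType) (hG : hausdorff_space G).
Context (theta : {measure set (borel G) -> \bar R}) (theta_haar : is_haar theta).
Local Open Scope ereal_scope.

Lemma haar_compact_fin_num (A : set G) : compact A -> theta A \is a fin_num.
Proof. by move=> cA; rewrite ge0_fin_numE //; exact: haar_compact_fin. Qed.

Lemma measure_setU_null (A N : set (borel G)) : measurable A -> measurable N ->
  theta N = 0 -> theta (A `|` N) = theta A.
Proof.
move=> mA mN N0; apply/eqP; rewrite eq_le; apply/andP; split.
  by rewrite -[leRHS]adde0 -N0; exact: measureU2.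
by apply: le_measure; rewrite ?inE //; exact: measurableU.
Qed.

(** Inner regularity of the open set [setT]: if all compact sets were null, the whole group would
    be. *)
Lemma haar_lt0_compact : exists2 Q : set G, compact Q & 0 < theta Q.
Proof.
apply: contrapT => nQ; move/eqP: (haar_neq0 theta_haar); apply.
rewrite (haar_inner_regular theta_haar openT); apply/eqP; rewrite eq_le; apply/andP; split.
  apply: ge_ereal_sup => _ [Q [cQ _] <-].
  by rewrite leNgt; apply/negP => Q0; apply: nQ; exists Q.
apply: ereal_sup_ubound; exists set0; last exact: measure0.
by split; [exact: compact0|].
Qed.

Lemma continuous_compact_haar_integrable (f : G -> R) (A : set G) :
  continuous f -> compact A -> theta.-integrable (A : set (borel G)) (EFin \o f).
Proof.
move=> cf cA; apply: measurable_bounded_integrable.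
- exact: compact_borel.
- exact: haar_compact_fin.
- by apply: measurable_funS (continuous_measurable_realfun cf).
have : compact (f @` A) by apply: continuous_compact => //; exact: continuous_subspaceT.
move=> /compact_bounded [M [Mr HM]]; exists M; split => // x Mx y Ay.
by apply: HM => //; exists y.
Qed.

End haar_basics.

(** * Nets, upper limits and suprema *)

Global Instance tail_filter (I : directed) : ProperFilter (tail I).
Proof.
split; first by move=> [i /(_ i (@dle_refl I i))].
split.
- by case: (dindex_inh I) => i; exists i.
- move=> P Q [i iP] [j jQ]; have [k [ik jk]] := @dle_ub I i j.
  by exists k => l kl; split; [apply: iP; exact: dle_trans kl|apply: jQ; exact: dle_trans kl].
- by move=> P Q PQ [i iP]; exists i => j /iP /PQ.
Qed.

Lemma counting_image (R : realType) (T U : choiceType) (f : T -> U) (S : set T) :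
  injective f -> finite_set S ->
  counting (f @` S) = counting S :> \bar R.
Proof.
move=> f_inj fS; have fS' : finite_set (f @` S) by exact: finite_image.
by rewrite /counting !asboolT // fset_set_image // card_imfset.
Qed.

Lemma net_limsup_pZl (R : realType) (I : directed) (u : I -> \bar R) (r : R) : 0 < r ->
  net_limsup (fun i => r%:E * u i)%E = (r%:E * net_limsup u)%E.
Proof.
move=> r0; rewrite /net_limsup -ereal_inf_pZl // image_comp; congr ereal_inf.
apply: eq_imagel => i _ /=; rewrite -ereal_sup_pZl // image_comp; congr ereal_sup.
Qed.

(** Meant for [s] and [s'] translating partitions or covers by [c0^-1] and [c0]. The cancellation
    hypothesis makes [s] map [P] onto itself, so both suprema run over the same values up to the
    factor [r]. *)
Lemma ereal_sup_reindex_pZl (R : realType) (T : Type) (P : set T) (F H : T -> \bar R)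
    (s s' : T -> T) (r : R) : 0 < r ->
  (forall a, P a -> P (s a)) -> (forall a, P a -> P (s' a)) -> cancel s' s ->
  (forall a, P a -> F a = r%:E * H (s a))%E ->
  ereal_sup (F @` P) = (r%:E * ereal_sup (H @` P))%E.
Proof.
move=> r0 Ps Ps' s'K FH; rewrite -ereal_sup_pZl // image_comp; congr ereal_sup.
apply/seteqP; split => [_ [a Pa <-]|_ [a Pa <-]].
  by exists (s a); [exact: Ps|rewrite FH].
by exists (s' a); [exact: Ps'|rewrite FH ?s'K //; exact: Ps'].
Qed.

(** * Translates of families of sets and their refinements *)

Section action_images.
Context (G : topologicalGroupType) (X : Type) (act : G -> X -> X).
Hypothesis act_action : is_action act.
Implicit Types (A : set X) (U : set (set X)).

Lemma act_imageM g h A : act g @` (act h @` A) = act (g * h)%g @` A.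
Proof. by rewrite image_comp; apply: eq_imagel => x _; rewrite (proj2 act_action). Qed.

Lemma act_image1 A : act 1%g @` A = A.
Proof. by rewrite -[RHS]image_id; apply: eq_imagel => x _; rewrite (proj1 act_action). Qed.

Lemma act_imageK g : cancel (image^~ (act g)) (image^~ (act g^-1%g)).
Proof. by move=> A /=; rewrite act_imageM mulVg act_image1. Qed.

Lemma act_imageVK g : cancel (image^~ (act g^-1%g)) (image^~ (act g)).
Proof. by move=> A /=; rewrite act_imageM mulgV act_image1. Qed.

Lemma act_image_preimage g A : act g @` A = act g^-1%g @^-1` A.
Proof.
apply/seteqP; split => [_ [x Ax <-] /=|x Ax].
  by rewrite -(proj2 act_action) mulVg (proj1 act_action).
by exists (act g^-1%g x) => //; rewrite -(proj2 act_action) mulgV (proj1 act_action).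
Qed.

Definition act_family g U : set (set X) := [set act g @` A | A in U].

Lemma act_familyK g : cancel (act_family g^-1%g) (act_family g).
Proof.
move=> U; rewrite /act_family image_comp -[RHS]image_id.
by apply: eq_imagel => A _; exact: act_imageVK.
Qed.

Lemma act_family_cover g U : \bigcup_(A in U) A = setT ->
  \bigcup_(A in act_family g U) A = setT.
Proof.
move=> UT; apply/seteqP; split => // x _.
have : (\bigcup_(A in U) A) (act g^-1%g x) by rewrite UT.
move=> [A UA Ax]; exists (act g @` A); first by exists A.
by rewrite act_image_preimage.
Qed.

(** Since [(c v)^-1 = v^-1 c^-1], the set chosen at [g = c v] contributes [v^-1 . (c^-1 . u (c v))],
    so a choice [u] from [U] on [c F] amounts to a choice from [c^-1 U] on [F]. *)
Lemma refinement_translate (W : subgroup G) (c : G) U (F : set (subgroup_type W)) :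
  refinement act U ([set c] *` (val @` F)) =
  refinement (restrict_action W act) (act_family c^-1%g U) F.
Proof.
have capE (u : G -> set X) (w : subgroup_type W -> set X) :
    (forall v, F v -> act c^-1%g @` u (c * val v)%g = w v) ->
    \bigcap_(g in [set c] *` (val @` F)) (act g^-1%g @` u g) =
    \bigcap_(v in F) (restrict_action W act v^-1%g @` w v).
  move=> uw; apply/seteqP; split => x xF.
    move=> v Fv; rewrite -uw // /restrict_action act_imageM.
    rewrite -[val v^-1%g]/((val v)^-1)%g -invgM.
    by apply: xF; exists c => //; exists (val v) => //; exists v.
  move=> _ [_ -> [_ [v Fv <-] <-]]; rewrite invgM -act_imageM uw //; exact: xF.
apply/seteqP; split => [_ [u Uu <-]|_ [w Ww <-]].
  exists (fun v : subgroup_type W => act c^-1%g @` u (c * val v)%g); last exact/esym/capE.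
  move=> v Fv; exists (u (c * val v)%g) => //; apply: Uu.
  by exists c => //; exists (val v) => //; exists v.
(* The choice must be defined on all of [G]. Off the coset [c W] it takes the default lattice
   element 1, a value that the intersection over [c F] never sees. *)
pose u g := act c @` w (insubd (1%g : subgroup_type W) (c^-1 * g)%g).
have uE v : u (c * val v)%g = act c @` w v by rewrite /u mulKg valKd.
exists u; last by apply: capE => v Fv; rewrite uE act_imageK.
move=> _ [_ -> [_ [v Fv <-] <-]]; rewrite uE.
by have [A UA <-] := Ww v Fv; rewrite act_imageVK.
Qed.

End action_images.

Section act_family_finite.
Context (R : realType) (G : topologicalGroupType).

Lemma act_family_partition d (X : measurableType d) (mu : probability X R)
    (act : G -> X -> X) (g : G) (alpha : set (set X)) :
  measure_preserving_action mu act ->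
  finite_partition alpha -> finite_partition (act_family act g alpha).
Proof.
move=> [act_action mact _ _] [fa ma ta ca]; split.
- exact: finite_image.
- move=> _ [A aA <-]; rewrite act_image_preimage // -[X in measurable X]setTI.
  by apply: mact => //; exact: ma.
- move=> _ _ [A aA <-] [A' aA' <-] [_ [[x Ax <-] [y Ay e]]].
  congr (_ @` _); apply: ta => //; exists x; split => //.
  suff -> : x = y by [].
  have := congr1 (act g^-1%g) e.
  by rewrite -!(proj2 act_action) mulVg !(proj1 act_action).
- exact: (act_family_cover act_action g).
Qed.

Lemma act_family_open_cover (X : topologicalType)
    (act : G -> X -> X) (g : G) (U : set (set X)) :
  continuous_action act ->
  finite_open_cover U -> finite_open_cover (act_family act g U).
Proof.
move=> [act_action cact] [fU oU cU]; split.
- exact: finite_image.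
- move=> _ [A aA <-]; rewrite act_image_preimage //.
  apply: open_comp; last exact: oU.
  move=> x _.
  apply: (@continuous_comp _ _ _ (fun x => (g^-1%g, x)) (fun p => act p.1 p.2)) => //.
    by apply: cvg_pair; [exact: cvg_cst|exact: cvg_id].
  exact: cact.
- exact: (act_family_cover act_action g).
Qed.

End act_family_finite.

(** * The tiling of [G] by translates of the fundamental domain *)

Section compact_translates.
Context (G : topologicalGroupType) (omega : subgroup G).
Local Notation T := (subgroup_type omega).
Hypothesis discrete_omega : forall v : T, open [set v].

(** Such [v] lie in the compact set [K^-1 Q], which contains only finitely many lattice points. *)
Lemma finite_translates_hit (K Q : set G) : compact K -> compact Q ->
  finite_set [set v : T | exists2 k, K k & Q (k * val v)%g].
Proof.
move=> cK cQ; have cV : compact ((fun x : G => x^-1)%g @` K *` Q).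
  apply: compact_setMg => //; apply: continuous_compact => //.
  exact/continuous_subspaceT/invg_continuous.
apply: sub_finite_set (finite_val_preimage discrete_omega cV) => v [k Kk Qkv].
by exists k^-1%g; [exists k|exists (k * val v)%g; rewrite ?mulKg].
Qed.

End compact_translates.

Section tiling.
Context (R : realType) (G : topologicalGroupType) (hG : hausdorff_space G).
Context (G_unimodular : unimodular R G).
Context (theta : {measure set (borel G) -> \bar R}) (theta_haar : is_haar theta).
Context (omega : subgroup G).
Local Notation T := (subgroup_type omega).
Hypothesis discrete_omega : forall v : T, open [set v].
Context (C : set G) (C_fundamental : fundamental_domain omega C).
Context (C_regular : theta (boundary C) = 0%E) (C_precompact : compact (closure C)).
Implicit Types S : set T.
Local Notation K := (closure C).

Definition translates (A : set G) (S : set T) : set G := A *` (val @` S).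

Lemma translatesE A S : translates A S = \bigcup_(v in S) (A *` [set val v]).
Proof.
apply/seteqP; split.
  move=> _ [a Aa [_ [v Sv <-] <-]].
  by exists v => //; exists a => //; exists (val v).
by move=> _ [v Sv [a Aa [_ -> <-]]]; exists a => //; exists (val v) => //; exists v.
Qed.

Lemma translates_cover (x : G) : exists2 c, C c & exists v : T, x = (c * val v)%g.
Proof.
have [_ /(_ x) [[c w] [[/= Cc Ww ->] _]]] := C_fundamental.
by have [v <-] := subgroup_val Ww; exists c => //; exists v.
Qed.

Lemma translates_uniq (c c' : G) (v v' : T) : C c -> C c' ->
  (c * val v = c' * val v')%g -> v = v'.
Proof.
move=> Cc Cc' e; have [_ /(_ (c * val v)%g) [p [_ pu]]] := C_fundamental.
have := pu (c, val v) (And3 Cc (val_subgroup v) erefl).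
rewrite (pu (c', val v') (And3 Cc' (val_subgroup v') e)) => -[_ /val_inj].
by move=> ->.
Qed.

Lemma trivIset_translates S : trivIset S (fun v => C *` [set val v]).
Proof.
move=> u v _ _ [_ [[c Cc [_ -> <-]] [c' Cc' [_ -> e]]]].
exact/esym/(translates_uniq Cc' Cc e).
Qed.

Lemma translates_setC S : ~` translates C S `<=` translates C (~` S).
Proof.
move=> x; have [c Cc [v ->]] := translates_cover x => nS.
exists c => //; exists (val v) => //; exists v => // Sv; apply: nS.
by exists c => //; exists (val v) => //; exists v.
Qed.

Lemma fundamental_measurable : measurable (C : set (borel G)).
Proof. by case: C_fundamental. Qed.

Lemma measurable_translates (A : set G) S : finite_set S ->
  measurable (A : set (borel G)) -> measurable (translates A S : set (borel G)).
Proof.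
move=> fS mA; rewrite translatesE; apply: fin_bigcup_measurable => // v _.
exact: mulr_borel.
Qed.

Local Open Scope ereal_scope.

Lemma sum_cst_counting S (r : R) : finite_set S ->
  \sum_(v \in S) r%:E = (r * fine (@counting _ R S))%:E.
Proof.
move=> fS; rewrite fsbig_finite //= sumEFin /counting asboolT //=.
by rewrite big_const_seq iter_addr addr0 count_predT mulr_natr.
Qed.

(** Subadditivity over the pieces [A v]. These are right translates, so it is unimodularity that
    gives each of them the measure of [A]. *)
Lemma haar_translates_le (A : set G) S : finite_set S ->
  measurable (A : set (borel G)) -> theta A \is a fin_num ->
  theta (translates A S) <= (fine (theta A) * fine (@counting _ R S))%:E.
Proof.
move=> fS mA fA; rewrite -sum_cst_counting // fineK //.
rewrite (_ : \sum_(v \in S) theta A = \sum_(v \in S) theta (A *` [set val v])); last first.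
  by apply: eq_fsbigr => v _; rewrite G_unimodular.
apply: content_sub_fsum => //; last by rewrite translatesE.
- by move=> v _; exact: mulr_borel.
- exact: measurable_translates.
Qed.

Lemma closure_fundamental : K = C `|` boundary C.
Proof.
apply/seteqP; split => [x Kx|x [/subset_closure //|[]//]].
have [Cx|nCx] := pselect (interior C x); first by left; exact: interior_subset.
by right.
Qed.

Lemma closed_boundary : closed (boundary C).
Proof.
apply: closedI; first exact: closed_closure.
by apply: open_closedC; exact: open_interior.
Qed.

Lemma fundamental_fin_num : theta C \is a fin_num.
Proof.
rewrite ge0_fin_numE //; apply: le_lt_trans (haar_compact_fin theta_haar C_precompact).
apply: le_measure; rewrite ?inE; [exact: fundamental_measurable| |exact: subset_closure].
exact: compact_borel.
Qed.

Lemma haar_closure_fundamental : theta K = theta C.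
Proof.
rewrite closure_fundamental measure_setU_null //.
- exact: fundamental_measurable.
- exact: (@closed_borel G _ closed_boundary).
Qed.

Lemma haar_translates S : finite_set S ->
  theta (translates C S) = (fine (theta C) * fine (@counting _ R S))%:E.
Proof.
move=> fS; rewrite translatesE measure_fin_bigcup //.
- rewrite -sum_cst_counting // fineK; last exact: fundamental_fin_num.
  by apply: eq_fsbigr => v _; apply: G_unimodular => //; exact: fundamental_measurable.
- exact: trivIset_translates.
- by move=> v _; apply: mulr_borel; exact: fundamental_measurable.
Qed.

Lemma haar_translates_closure S : finite_set S ->
  theta (translates K S) = (fine (theta C) * fine (@counting _ R S))%:E.
Proof.
move=> fS; apply/eqP; rewrite eq_le; apply/andP; split.
  rewrite -haar_closure_fundamental; apply: haar_translates_le => //.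
    exact: compact_borel.
  exact: haar_compact_fin_num.
rewrite -haar_translates //; apply: le_measure; rewrite ?inE.
- by apply: measurable_translates => //; exact: fundamental_measurable.
- by apply: measurable_translates => //; exact: compact_borel.
- by apply: setMgSS => //; exact: subset_closure.
Qed.

(** A compact set of positive measure is covered by the finitely many [K v] that meet it, and these
    would be null together with [C]. *)
Lemma fundamental_gt0 : 0 < theta C.
Proof.
rewrite lt0e measure_ge0 andbT; apply/eqP => C0.
have [Q cQ] := haar_lt0_compact theta_haar; apply/negP; rewrite -leNgt.
set S := [set v : T | exists2 k, K k & Q (k * val v)%g].
have fS : finite_set S by exact: finite_translates_hit.
have -> : 0 = theta (translates K S).
  by rewrite haar_translates_closure // C0 /= mul0r.
apply: le_measure; rewrite ?inE; first exact: compact_borel.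
  by apply: measurable_translates => //; exact: compact_borel.
move=> x Qx; have [c Cc [v xE]] := translates_cover x.
exists c; first exact: subset_closure.
exists (val v) => //; exists v => //; exists c; first exact: subset_closure.
by rewrite -xE.
Qed.

Lemma fundamental_fine_gt0 : (0 < fine (theta C))%R.
Proof. by rewrite fine_gt0 // fundamental_gt0 /= ltey_eq fundamental_fin_num. Qed.

(** A set of positive measure with null boundary has an interior point [c]. Then [C v] is a
    neighbourhood of [c v], so if [c v] is adherent to [C], the tiles [C v] and [C] meet and
    uniqueness forces [v = 1]. *)
Lemma fundamental_interior : exists2 c, C c & forall v : T, K (c * val v)%g -> v = 1%g.
Proof.
have [c Cc] : interior C !=set0.
  apply/set0P/eqP => C0; have := fundamental_gt0.
  rewrite -haar_closure_fundamental; move: C_regular.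
  by rewrite /boundary C0 setD0 => ->; rewrite ltxx.
exists c; first exact: interior_subset.
move=> v Kcv; have : nbhs (c * val v)%g (C *` [set val v]).
  rewrite setMg1r_preimage.
  have := @continuous_rmulg G (val v)^-1%g (c * val v)%g; apply.
  by rewrite mulgK.
move=> /Kcv [x [Cx [c' Cc' [_ -> e]]]].
apply/esym/(translates_uniq Cx Cc'); rewrite e; exact: mulg1.
Qed.

(** * The density of the lattice *)

Section lattice_density.
Context (A : van_hove_net theta).

Lemma vh_boundary_closed (L B : set G) : compact L -> closed (vh_boundary L B).
Proof.
by move=> cL; apply: closedI; apply: closed_compact_setMg => //; exact: closed_closure.
Qed.

Lemma vh_boundary_fin_num (L B : set G) : compact L -> compact B ->
  theta (vh_boundary L B) \is a fin_num.
Proof.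
move=> cL cB; apply: haar_compact_fin_num => //.
have cLB : compact (L *` closure B).
  by apply: compact_setMg => //; rewrite -(proj1 (closure_id _) _)//; exact: compact_closed.
by apply: (subclosed_compact (vh_boundary_closed cL) cLB) => x [].
Qed.

(* The symmetric difference of B and C (B `&` omega) lies in this boundary. *)
Lemma haar_lattice_points (B : set G) : compact B ->
  (`|fine (theta C) * fine (counting (B `&` omega) : \bar R) - fine (theta B)| <=
    fine (theta (vh_boundary (K `|` [set 1%g]) B)))%R.
Proof.
move=> cB; set L := _ `|` _.
have cL : compact L by apply: compactU => //; exact: compact_set1.
set S := (val : T -> G) @^-1` B.
have fS : finite_set S by exact: finite_val_preimage.
have -> : B `&` omega = val @` S.
  apply/seteqP; split=> [x [Bx /subgroup_val [v vx]]|_ [v Sv <-]].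
    by exists v => //; rewrite /S /= vx.
  by split => //; exact: val_subgroup.
rewrite (@counting_image R T G (val : T -> G) S val_inj fS).
have mB : measurable (B : set (borel G)) by exact: compact_borel.
have mD : measurable (vh_boundary L B : set (borel G)).
  exact: (@closed_borel G _ (vh_boundary_closed cL)).
have mK : measurable (K : set (borel G)) by exact: compact_borel.
have mC := fundamental_measurable.
have L1 : L 1%g by right.
have CL c : C c -> L c by move=> Cc; left; exact: subset_closure.
have le1 : theta B <= theta (translates K S `|` vh_boundary L B).
  apply: le_measure; rewrite ?inE //.
    by apply: measurableU => //; exact: measurable_translates.
  move=> x Bx; have [c Cc [v xE]] := translates_cover x.
  have [Sv|nSv] := pselect (S v).
    left; exists c; first exact: subset_closure.
    by exists (val v) => //; exists v.
  right; split.
    by exists 1%g => //; exists x; [exact: subset_closure|rewrite mul1g].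
  by exists c; [exact: CL|exists (val v); [exact: subset_closure|]].
have le2 : theta (translates C S) <= theta (B `|` vh_boundary L B).
  apply: le_measure; rewrite ?inE //.
  - exact: measurable_translates.
  - exact: measurableU.
  move=> _ [c Cc [_ [v Sv <-] <-]].
  have [Bx|nBx] := pselect (B (c * val v)%g); first by left.
  right; split.
    by exists c; [exact: CL|exists (val v); [exact: subset_closure|]].
  by exists 1%g => //; exists (c * val v)%g; [exact: subset_closure|rewrite mul1g].
have fB : theta B \is a fin_num by exact: haar_compact_fin_num.
have fD : theta (vh_boundary L B) \is a fin_num by exact: vh_boundary_fin_num.
have {}le2 : theta (translates C S) <= theta B + theta (vh_boundary L B).
  by apply: le_trans le2 _; exact: measureU2.
have {}le1 : theta B <= theta (translates K S) + theta (vh_boundary L B).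
  by apply: le_trans le1 _; apply: measureU2 => //; exact: measurable_translates.
move: le2 le1; rewrite haar_translates // haar_translates_closure //.
rewrite -(fineK fB) -(fineK fD) -!EFinD !lee_fin => h2 h1.
by rewrite ler_distl lerBlDr h1 h2.
Qed.

(** Dividing the bound of [haar_lattice_points] by [theta C * theta (A i)] squeezes the quotient
    between [t^-1 (1 - b i)] and [t^-1 (1 + b i)]. The van Hove property for the compact set [L]
    gives [b --> 0]. *)
Lemma density_fundamental_domain : density omega A = (fine (theta C))^-1%R.
Proof.
set t := fine (theta C).
have t0 : (0 < t)%R by exact: fundamental_fine_gt0.
apply: cvg_lim => //.
set L := K `|` [set 1%g].
have cL : compact L by apply: compactU => //; exact: compact_set1.
pose b i := (fine (theta (vh_boundary L (A i))) / fine (theta (A i)))%R.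
have b0 : b @ tail A --> (0 : R)%R by exact: vh_lim.
apply: (@squeeze_cvgr _ _ _ _ (fun i => t^-1 - t^-1 * b i) (fun i => t^-1 + t^-1 * b i))%R.
- near=> i.
  have a0 : (0 < fine (theta (A i)))%R.
    rewrite fine_gt0 //; apply/andP; split; first by near: i; exact: vh_pos.
    by apply: haar_compact_fin => //; exact: vh_compact.
  have := haar_lattice_points (@vh_compact _ _ _ A i).
  rewrite -/t -/L /b ler_distl => /andP[h1 h2].
  set a := fine (theta (A i)) in a0 h1 h2 *.
  set e := fine (theta (vh_boundary L (A i))) in h1 h2 *.
  have -> : (t^-1 - t^-1 * (e / a) = (a - e) / a / t)%R.
    by rewrite [in RHS]mulrBl divff ?gt_eqF // mulrBl mul1r (mulrC (e / a)%R).
  have -> : (t^-1 + t^-1 * (e / a) = (a + e) / a / t)%R.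
    by rewrite [in RHS]mulrDl divff ?gt_eqF // mulrDl mul1r (mulrC (e / a)%R).
  rewrite ler_pdivrMr // ler_pdivlMr // mulrAC.
  by rewrite !ler_pM2r ?invr_gt0 // mulrC h1 h2.
- rewrite -[X in _ --> X]subr0 -[X in (_ - X)%R](mulr0 t^-1%R).
  by apply: cvgB; [exact: cvg_cst|exact: cvgMr].
- rewrite -[X in _ --> X]addr0 -[X in (_ + X)%R](mulr0 t^-1%R).
  by apply: cvgD; [exact: cvg_cst|exact: cvgMr].
Unshelve. all: by end_near. Qed.

End lattice_density.

(** * Van Hove nets and Delone sets transported from the lattice to [G] *)

Section tiled_choice.
Let card := counting_haar R T.

Lemma vh_boundary_translates (L : set G) : compact L ->
  exists2 M : set T, finite_set M & forall S, finite_set S ->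
    vh_boundary L (translates K S) `<=` translates K (vh_boundary M S).
Proof.
move=> cL; exists [set v : T | exists2 k, K k & (L *` K) (k * val v)%g].
  by apply: finite_translates_hit => //; exact: compact_setMg.
move=> S fS; set M := [set _ | _] => x.
(* If [c v = l k u], then [c (v u^-1) = l k] lies in [L K], so [v u^-1] belongs to [M]. This is
   applied to [U = S] and to its complement. *)
have hit (U : set T) (c : G) (v : T) : C c ->
    (L *` (translates K U)) (c * val v)%g -> (M *` U) v.
  move=> Cc [l Ll [_ [k Kk [_ [u Uu <-] <-]] e]].
  exists (v * u^-1)%g; last by exists u => //; rewrite mulgVK.
  exists c; first exact: subset_closure.
  exists l => //; exists k => //.
  apply: (can_inj (mulgK (val u))).
  by rewrite -[RHS]mulgA (_ : (val (v * u^-1) * val u = val v)%g) -?e ?mulgA //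
    -[LHS]/(val (v * u^-1 * u)%g) mulgVK.
have cKS : closed (translates K S).
  by apply: closed_compact_setMg => //; exact: closed_val_image.
have cKnS : closed (translates K (~` S)).
  by apply: closed_compact_setMg => //; exact: closed_val_image.
have [c Cc [v ->]] := translates_cover x.
rewrite /vh_boundary -(proj1 (closure_id _) cKS) => -[h1 h2].
exists c; first exact: subset_closure.
exists (val v) => //; exists v => //; rewrite !discrete_subgroup_closure //.
split; first exact: hit Cc h1.
apply: hit Cc _; move: (c * val v)%g h2; apply: setMgSS => //.
(* The complement of [K S] lies in that of [C S], hence in [C (~]
   S)[because the tiles cover]G[, hence in the closed set]K (~[S)], which therefore also contains
   its closure. *)
rewrite [X in _ `<=` X](closure_id _).1 //; apply: closure_subset.
apply: subset_trans (setMgSS (@subset_closure _ C) (@subset_refl _ _)).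
apply: subset_trans (@translates_setC S); apply: subsetC.
by apply: setMgSS => //; exact: subset_closure.
Qed.

Context (B : van_hove_net card).

Lemma vh_set_finite i : finite_set (B i).
Proof. by apply: compact_discrete_subgroup => //; exact: vh_compact. Qed.

Let tiled_compact i : compact (translates K (B i)).
Proof.
apply: compact_setMg => //; apply: finite_compact; apply: finite_image.
exact: vh_set_finite.
Qed.

Lemma counting_finE S : finite_set S -> card S = (fine (@counting _ R S))%:E.
Proof. by move=> fS; rewrite /card /counting_haar /= /counting asboolT. Qed.

Let tiled_pos : \forall i \near tail B, 0 < theta (translates K (B i)).
Proof.
have := vh_pos B; apply: filterS => i.
rewrite haar_translates_closure ?lte_fin; last exact: vh_set_finite.
rewrite counting_finE ?lte_fin; last exact: vh_set_finite.
by apply: mulr_gt0; exact: fundamental_fine_gt0.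
Qed.

(** By [vh_boundary_translates] the numerator is at most [theta C] times the size of the
    [M]-boundary of [B i]. The factor [theta C] cancels, leaving the boundary ratio of [B i] for the
    finite, hence compact, set [M]. *)
Let tiled_lim (L : set G) : compact L ->
  (fun i => fine (theta (vh_boundary L (translates K (B i)))) /
    fine (theta (translates K (B i))))%R @ tail B --> (0 : R)%R.
Proof.
move=> cL; have [M fM LM] := vh_boundary_translates cL.
have := @vh_lim _ _ _ B M (finite_compact fM).
apply: (@squeeze_cvgr _ _ _ _ (cst 0%R)); last exact: cvg_cst.
have t0 := fundamental_fine_gt0.
near=> i => /=; apply/andP; split; first by rewrite divr_ge0 // fine_ge0.
have fB := vh_set_finite i.
have fD : finite_set (vh_boundary M (B i)).
  apply: sub_finite_set (finite_setMg fM fB) => x [].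
  by rewrite discrete_subgroup_closure.
have B0 : (0 < fine (@counting _ R (B i)))%R.
  by rewrite -lte_fin -counting_finE //; near: i; exact: vh_pos.
have -> : fine (theta (translates K (B i))) =
    (fine (theta C) * fine (@counting _ R (B i)))%R by rewrite haar_translates_closure.
rewrite [fine (card (B i))]/(fine (@counting _ R (B i))).
rewrite ler_pdivrMr ?mulr_gt0 // mulrAC mulrA mulfK; last by rewrite gt_eqF.
rewrite mulrC -lee_fin -haar_translates_closure // fineK; last first.
  by apply: vh_boundary_fin_num => //; exact: tiled_compact.
apply: le_measure; rewrite ?inE; last exact: LM.
  by apply: (@closed_borel G); exact: vh_boundary_closed.
by apply: measurable_translates => //; exact: compact_borel.
Unshelve. all: by end_near. Qed.

Definition tiled_net : van_hove_net theta :=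
  VanHoveNet tiled_compact tiled_pos tiled_lim.

End tiled_choice.

Section tiled_delone.
Context (c0 : G) (D : set T).

Lemma delone_translate : delone D -> delone ([set c0] *` (val @` D)).
Proof.
move=> [_ [L cL LD]]; split.
  have [N N1 sepN] := discrete_subgroup_sep discrete_omega 1%g.
  have cV : continuous (fun p : G * G => p.1 * p.2^-1)%g.
    by apply: continuous_mulg; [|apply: continuous_invg] => p; [exact: cvg_fst|exact: cvg_snd].
  have := cV (1%g, 1%g) N; rewrite /= mulgV => /(_ N1) [[U1 U2] /= [U11 U21] sub].
  (* If [c0 v u = c0 v' u'] with [u], [u'] in this set, then [v^-1 v' = u u'^-1] lies in [N], whose
     only lattice point is 1. *)
  exists (U1 `&` U2); first exact: filterI.
  move=> _ _ [_ -> [_ [v _ <-] <-]] [_ -> [_ [v' _ <-] <-]].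
  move=> [y [[_ -> [u [Uu _] <-]] [_ -> [u' [_ Uu'] e]]]].
  have {}e : (val v' * u' = val v * u)%g by apply: (mulgI c0); rewrite !mulgA.
  have uu' : val (v^-1 * v')%g = (u * u'^-1)%g.
    rewrite -[LHS]/((val v)^-1 * val v')%g.
    by apply: (mulgI (val v)); apply: (mulIg u'); rewrite mulVKg -!mulgA mulVg mulg1.
  have : (v^-1 * v')%g = 1%g.
    apply: sepN; last exact: nbhs_singleton.
    by rewrite uu'; apply: (sub (u, u')).
  by move=> /(congr1 (fun z => v * z)%g); rewrite mulVKg mulg1 => ->.
have fL : finite_set L by exact: compact_discrete_subgroup.
(* From [v = l d] one gets [c v = (c l c0^-1) (c0 d)], which dictates this compact set. *)
exists (K *` (val @` L) *` [set c0^-1%g]).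
  apply: compact_setMg; last exact: compact_set1.
  by apply: compact_setMg => //; apply: finite_compact; exact: finite_image.
apply/seteqP; split => // x _; have [c Cc [v ->]] := translates_cover x.
have : (L *` D) v by rewrite LD.
move=> [l Ll [d Dd <-]].
exists (c * val l * c0^-1)%g.
  exists (c * val l)%g; last by exists c0^-1%g.
  exists c; first exact: subset_closure.
  by exists (val l) => //; exists l.
exists (c0 * val d)%g; first by exists c0 => //; exists (val d) => //; exists d.
by rewrite -!mulgA mulKg.
Qed.

(** A common point [k s = c0 d] gives [c0 (d s^-1) = k] in [K], hence [d = s]. *)
Lemma translates_setI S : (forall v : T, K (c0 * val v)%g -> v = 1%g) -> C c0 ->
  translates K S `&` ([set c0] *` (val @` D)) = [set c0] *` (val @` (S `&` D)).
Proof.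
move=> Kc0 Cc0; apply/seteqP; split.
  move=> _ [[k Kk [_ [s Ss <-] <-]] [_ -> [_ [d Dd <-] e]]].
  have ds : (d * s^-1)%g = 1%g.
    apply: Kc0; rewrite -[val _]/(val d * (val s)^-1)%g mulgA e mulgK //.
  exists c0 => //; exists (val d) => //; exists d => //; split => //.
  by move: ds => /(congr1 (fun z => z * s)%g); rewrite mulgVK mul1g => ->.
move=> _ [_ -> [_ [v [Sv Dv] <-] <-]]; split.
  exists c0; first exact: subset_closure.
  by exists (val v) => //; exists v.
by exists c0 => //; exists (val v) => //; exists v.
Qed.

End tiled_delone.

Definition tiled_choice (c0 : G) (c : OW_choice (counting_haar R T)) : OW_choice theta :=
  @OWChoice _ _ _ (tiled_net c) _ (delone_translate c0 (OW_deloneP c)).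

(** * Integration over unions of translates *)

Section translates_integral.
Context (f : G -> R) (cf : continuous f).

Let continuous_comp_rmulg (g : G) : continuous (fun x => f (x * g)%g).
Proof.
move=> x; apply: (@continuous_comp _ _ _ (fun y => y * g)%g f); last exact: cf.
exact: continuous_rmulg.
Qed.

(** Change of variables along right translation by [g], whose pushforward of [theta] is [theta] by
    unimodularity. *)
Lemma integral_rmulg (A : set G) (g : G) : compact A ->
  \int[theta]_(x in (A *` [set g] : set (borel G))) (f x)%:E =
  \int[theta]_(x in (A : set (borel G))) (f (x * g)%g)%:E.
Proof.
move=> cA.
have mg : measurable_fun setT ((fun x => x * g)%g : borel G -> borel G).
  by apply: (@continuous_borel G G); exact: continuous_rmulg.
have pre : (fun x => x * g)%g @^-1` (A *` [set g]) = A.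
  by rewrite setMg1r_preimage; apply/seteqP; split => x /=; rewrite mulgK.
have cAg : compact (A *` [set g]) by apply: compact_setMg => //; exact: compact_set1.
have := @integral_pushforward _ _ _ _ R _ mg theta (A *` [set g]) (EFin \o f).
rewrite pre => <-.
- apply: eq_measure_integral => U mU _; rewrite /pushforward.
  rewrite -(G_unimodular theta_haar g^-1%g mU); congr (theta _).
  by rewrite setMg1r_preimage invgK.
- apply/measurable_realfun.measurable_EFinP; exact: (@continuous_measurable_realfun R G).
- rewrite -[_ \o _]/(EFin \o (fun x => f (x * g)%g)).
  exact: continuous_compact_haar_integrable.
- exact: compact_borel.
Qed.

(** The two sets are nested and have the same finite measure, so their difference is null. *)
Lemma integral_translates_closure S : finite_set S ->
  \int[theta]_(x in (translates K S : set (borel G))) (f x)%:E =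
  \int[theta]_(x in (translates C S : set (borel G))) (f x)%:E.
Proof.
move=> fS; have mK : measurable (translates K S : set (borel G)).
  by apply: measurable_translates => //; exact: compact_borel.
have mC : measurable (translates C S : set (borel G)).
  by apply: measurable_translates => //; exact: fundamental_measurable.
have CK : translates C S `<=` translates K S.
  by apply: setMgSS => //; exact: subset_closure.
have cK : compact (translates K S).
  by apply: compact_setMg => //; apply: finite_compact; exact: finite_image.
have fK : theta (translates K S) < +oo by exact: haar_compact_fin.
rewrite (@negligible_integral _ _ _ theta _ (translates K S `\` translates C S)) //.
- by rewrite setDD setIidr.
- exact: measurableD.
- exact: continuous_compact_haar_integrable.
- transitivity (theta (translates K S) - theta (translates C S)).
    by rewrite measureD // setIidr.
  by rewrite haar_translates_closure // haar_translates // subee.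
Qed.

(** The integral is split over the disjoint tiles [C v], which requires passing from [K] to [C];
    each tile is then enlarged back to [K v] and translated to [K]. *)
Lemma Rintegral_translates S : finite_set S ->
  (\int[theta]_(x in (translates K S : set (borel G))) f x =
  \int[counting_haar R T]_(v in (S : set (borel T)))
    \int[theta]_(g in (K : set (borel G))) f (g * val v)%g)%R.
Proof.
move=> fS; rewrite [LHS]/Rintegral [RHS]/Rintegral; congr fine.
rewrite integral_translates_closure //.
have /finite_seqP[s0 sE] := fS; have us : uniq (undup s0) by exact: undup_uniq.
have {sE} SE : S = [set` undup s0].
  by rewrite sE; apply/seteqP; split => v /=; rewrite mem_undup.
move: (undup s0) us SE => s us SE.
have mT (U : set (borel T)) : measurable U.
  by apply: (@open_borel T); exact: discrete_subgroup_open.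
rewrite translatesE {1}SE bigcup_seq integral_bigsetU_EFin //; first last.
- rewrite -bigcup_seq -SE -translatesE.
  apply: measurable_funS (_ : measurable_fun setT _) => //.
  by apply/measurable_realfun.measurable_EFinP; exact: (@continuous_measurable_realfun R G).
- exact: trivIset_translates.
- by move=> v; apply: mulr_borel; exact: fundamental_measurable.
have -> : S = \big[setU/set0]_(v <- s) [set v].
  by rewrite -bigcup_seq -SE bigcup_imset1 image_id.
rewrite integral_bigsetU_EFin //; last by move=> u v _ _ [x [<- <-]].
apply: eq_bigr => v _.
rewrite -[X in _ *` X](image_set1 val) -[_ *` _]/(translates C [set v]).
rewrite -integral_translates_closure // /translates image_set1 integral_rmulg //.
(* On the singleton of [v] the integrand is constant, and counting measure gives the singleton mass
   1. *)
rewrite [RHS](eq_integral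
  (cst (\int[theta]_(g in (K : set (borel G))) f (g * val v)%g)%R%:E)); last first.
  by move=> u; rewrite inE => ->.
rewrite integral_cst // /counting_haar /= /counting asboolT //.
rewrite fset_set1 cardfs1 mule1 fineK //.
apply: integrable_fin_num; first exact: compact_borel.
rewrite -[fun _ => _]/(EFin \o (fun x => f (x * val v)%g)).
apply: continuous_compact_haar_integrable => //.
Qed.

End translates_integral.

(** * Entropy and pressure along the tiled choice *)

Section lattice_actions.
Context (c0 : G) (Cc0 : C c0) (c0_interior : forall v : T, K (c0 * val v)%g -> v = 1%g).
Context (c : OW_choice (counting_haar R T)).
Local Notation t := (fine (theta C)).

Let t_gt0 : (0 < t^-1)%R.
Proof. by rewrite invr_gt0; exact: fundamental_fine_gt0. Qed.

Let haar_tiled i : (fine (theta (translates K (c i))))^-1%R =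
  (t^-1 * (fine (counting_haar R T (c i)))^-1)%R.
Proof.
by rewrite haar_translates_closure ?invfM //; exact: vh_set_finite.
Qed.

Lemma OW_entropy_lattice d (X : measurableType d) (mu : probability X R)
    (act : G -> X -> X) : measure_preserving_action mu act ->
  OW_entropy mu act (tiled_choice c0 c) =
  t^-1%:E * OW_entropy mu (restrict_action omega act) c.
Proof.
move=> mact; have [act_action _ _ _] := mact.
(* The partition [alpha] for [G] is matched with [c0^-1 alpha] for the lattice; the two quotients
   then differ by [t^-1] at every index of the net. *)
apply: (@ereal_sup_reindex_pZl _ _ _ _ _ (act_family act c0^-1%g) (act_family act c0)) => //.
- by move=> a; exact: (act_family_partition _ mact).
- by move=> a; exact: (act_family_partition _ mact).
- by rewrite -{1}(invgK c0); exact: act_familyK.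
move=> a _; rewrite -net_limsup_pZl //; congr net_limsup; apply/funext => i /=.
rewrite translates_setI // refinement_translate // haar_tiled.
by rewrite mulrCA EFinM.
Qed.

(** The action law turns [f (g v . x)] into [f (g . (v . x))], so the integral over [K] attached to
    the tile of [v] is the value of [f_K] at [v . x]. *)
Lemma orbit_integral_lattice (X : topologicalType) (act : G -> X -> X) (f : X -> R)
    (S : set T) : continuous_action act -> continuous f -> finite_set S ->
  orbit_integral theta act f (translates K S) =
  orbit_integral (counting_haar R T) (restrict_action omega act)
    (orbit_integral theta act f K) S.
Proof.
move=> [act_action cact] cf fS; apply/funext => x; rewrite /orbit_integral.
have cfx : continuous (fun g => f (act g x)).
  move=> g; apply: (@continuous_comp _ _ _ (fun g => act g x) f); last exact: cf.
  apply: (@continuous_comp _ _ _ (fun g => (g, x)) (fun p => act p.1 p.2)).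
    by apply: cvg_pair; [exact: cvg_id|exact: cvg_cst].
  exact: cact.
rewrite (Rintegral_translates cfx fS); apply: eq_Rintegral => v _.
by apply: eq_Rintegral => g _; rewrite (proj2 act_action).
Qed.

Lemma OW_pressure_lattice (X : topologicalType) (act : G -> X -> X) (f : X -> R) :
  continuous_action act -> continuous f ->
  OW_pressure act f (tiled_choice c0 c) =
  t^-1%:E * OW_pressure (restrict_action omega act) (orbit_integral theta act f K) c.
Proof.
move=> cact cf; have [act_action _] := cact.
apply: (@ereal_sup_reindex_pZl _ _ _ _ _ (act_family act c0^-1%g) (act_family act c0)) => //.
- by move=> a; exact: act_family_open_cover.
- by move=> a; exact: act_family_open_cover.
- by rewrite -{1}(invgK c0); exact: act_familyK.
move=> a _; rewrite -net_limsup_pZl //; congr net_limsup; apply/funext => i /=.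
rewrite translates_setI // refinement_translate // haar_tiled.
rewrite orbit_integral_lattice //; last exact: vh_set_finite.
by rewrite EFinM muleCA.
Qed.

End lattice_actions.

End tiling.

(** * Restriction of actions to the lattice, and the comparison of [G] with the lattice *)

Lemma measure_preserving_restrict (R : realType) (G : topologicalGroupType)
    (W : subgroup G) d (X : measurableType d) (mu : probability X R)
    (act : G -> X -> X) :
  measure_preserving_action mu act ->
  measure_preserving_action mu (restrict_action W act).
Proof.
move=> [[act1 actM] mact pact cact]; split.
- by split => [|u v]; [exact: act1|exact: actM].
- by move=> v; exact: mact.
- by move=> v; exact: pact.
- move=> A mA v; apply: (@continuous_comp _ _ _ (val : subgroup_type W -> G)
    (fun g => fine (mu (A `+` (act g @` A))))); last exact: cact.
  exact: initial_continuous.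
Qed.

Lemma continuous_action_restrict (G : topologicalGroupType) (W : subgroup G)
    (X : topologicalType) (act : G -> X -> X) :
  continuous_action act -> continuous_action (restrict_action W act).
Proof.
move=> [[act1 actM] cact]; split; first by split => [|u v]; [exact: act1|exact: actM].
move=> [v x].
apply: (@continuous_comp _ _ _ (fun p : subgroup_type W * X => (val p.1, p.2))
  (fun p => act p.1 p.2)).
  apply: cvg_pair; last exact: cvg_snd.
  apply: (@continuous_comp _ _ _ fst (val : subgroup_type W -> G)); first exact: cvg_fst.
  exact: initial_continuous.
exact: cact.
Qed.

Theorem theorem6p30 (R : realType) (G : topologicalGroupType)
    (G_hausdorff : hausdorff_space G)
    (G_locally_compact : locally_compact [set: G])
    (G_amenable : amenable R G) (G_unimodular : unimodular R G)
    (theta : {measure set (borel G) -> \bar R}) (theta_haar : is_haar theta)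
    (omega : subgroup G) (omega_lattice : uniform_lattice omega)
    (C : set G) (C_fundamental : fundamental_domain omega C)
    (C_regular : theta (boundary C) = 0%E) (C_precompact : compact (closure C)) :
  let card := counting_haar R (subgroup_type omega) in
  (forall (d : measure_display) (X : measurableType d) (mu : probability X R)
      (pi : G -> X -> X),
    measure_preserving_action mu pi ->
    let phi := restrict_action omega pi in
    measure_preserving_action mu phi /\
    ((forall c c' : OW_choice theta,
        OW_entropy mu pi c = OW_entropy mu pi c') ->
     forall (c : OW_choice theta) (c' : OW_choice card) (A : van_hove_net theta),
       OW_entropy mu pi c =
       ((density omega A)%:E * OW_entropy mu phi c')%E)) /\
  (forall (X : topologicalType) (pi : G -> X -> X),
    compact [set: X] -> hausdorff_space X -> continuous_action pi ->
    let phi := restrict_action omega pi in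
    continuous_action phi /\
    forall f : X -> R, continuous f ->
    (forall c c' : OW_choice theta,
        OW_pressure pi f c = OW_pressure pi f c') ->
     forall (c : OW_choice theta) (c' : OW_choice card) (A : van_hove_net theta),
       OW_pressure pi f c =
       ((density omega A)%:E *
        OW_pressure phi (orbit_integral theta pi f (closure C)) c')%E).
Proof.
have [discrete_omega _] := omega_lattice.
have [c0 Cc0 c0P] := fundamental_interior G_hausdorff G_unimodular theta_haar
  discrete_omega C_fundamental C_regular C_precompact.
move=> card; split.
  move=> d X mu pi pi_mp phi; split; first exact: measure_preserving_restrict.
  move=> indep c c' A.
  rewrite (density_fundamental_domain G_hausdorff G_unimodular theta_haar
    discrete_omega C_fundamental C_regular C_precompact A).
  (* Independence of the choice on [G] allows [c] to be replaced by the choice tiled from the given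
     lattice choice [c'], for which the identity holds term by term. *)
  pose b := tiled_choice G_hausdorff G_unimodular theta_haar discrete_omega
    C_fundamental C_regular C_precompact c0 c'.
  rewrite (indep c b); exact: OW_entropy_lattice.
move=> X pi _ _ pi_cont phi; split; first exact: continuous_action_restrict.
move=> f f_cont indep c c' A.
rewrite (density_fundamental_domain G_hausdorff G_unimodular theta_haar
  discrete_omega C_fundamental C_regular C_precompact A).
pose b := tiled_choice G_hausdorff G_unimodular theta_haar discrete_omega
  C_fundamental C_regular C_precompact c0 c'.
rewrite (indep c b); exact: OW_pressure_lattice.
Qed.
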